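(* The following three iterated limits are equal: \[\lim_{k\to\infty}\lim_{N\to\infty}\frac{\log G'_{1/[k]}(N)}{\log N}=\lim_{k\to\infty}\lim_{N\to\infty}\frac{\log G'_{k}(N)}{\log N}=\lim_{k\to\infty}\lim_{N\to\infty}\frac{\log F'_{k}(N)}{\log N}.\]
   Context: For a set $U$ of numbers, a $U$-pattern with basepoint $x$ and (nonzero) scaling factor $r$ is the set $x+r\cdot U=\{x+ru:u\in U\}$. Let $[k]=\{1,\dots,k\}$ and $1/[k]=\{1/i:i\in[k]\}$. $G'_{1/[k]}(N)$ is the size of the smallest set of rational numbers that contains a $1/[k]$-pattern with basepoint $a$ for $N$ distinct integer values of $a$. $G'_k(N)$ is the size of the smallest set of integers that contains a $k$-term arithmetic progression $\{x+r,x+2r,\dots,x+kr\}$ (a $[k]$-pattern) with basepoint $x$, for $N$ distinct integer values of $x$. $F'_k(N)$ is the size of the smallest set of integers containing a $k$-term arithmetic progression with common difference $d$ for $N$ distinct integer values of $d$. *)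

(* Defs.v *)
From mathcomp Require Export all_boot all_order all_algebra finmap.
From mathcomp Require Export all_classical all_reals all_analysis.
Export Order.TTheory GRing.Theory Num.Theory.
Export numFieldNormedType.Exports.

Set Implicit Arguments.
Unset Strict Implicit.
Unset Printing Implicit Defensive.

Local Open Scope fset_scope.
Local Open Scope classical_set_scope.
Local Open Scope ring_scope.

Definition pattern (A : nzRingType) (U : {fset A}) (x r : A) : {fset A} :=
  [fset (x + r * u)%R | u in U]%fset.

Definition interval1 (k : nat) : {fset int} :=
  [fset (i%:Z)%R | i in iota 1 k]%fset.

Definition inv_interval1 (k : nat) : {fset rat} :=
  [fset ((i%:R)^-1 : rat)%R | i in iota 1 k]%fset.

Definition basepoints_inv (k N : nat) (S : {fset rat}) : Prop :=
  exists2 B : {fset int}, #|` B| = N &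
    forall a : int, a \in B ->
      exists2 r : rat, r != 0 & (pattern (inv_interval1 k) a%:~R r `<=` S)%fset.

(* A scaling factor of a [k]-pattern (k >= 1) with integer basepoint lying in a
   set of integers is automatically an integer, so r ranges over int. *)
Definition basepoints (k N : nat) (S : {fset int}) : Prop :=
  exists2 B : {fset int}, #|` B| = N &
    forall x : int, x \in B ->
      exists2 r : int, r != 0 & (pattern (interval1 k) x r `<=` S)%fset.

Definition differences (k N : nat) (S : {fset int}) : Prop :=
  exists2 D : {fset int}, #|` D| = N &
    forall d : int, d \in D ->
      d != 0 /\ exists x : int, (pattern (interval1 k) x d `<=` S)%fset.

Definition is_min_card (T : choiceType) (P : {fset T} -> Prop) (n : nat) : Prop :=
  (exists2 S : {fset T}, P S & #|` S| = n) /\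
  (forall S : {fset T}, P S -> (n <= #|` S|)%N).

(* The default value 0 is never used for the three families below: see
   G_inv_min, G_AP_min and F_AP_min. *)
Definition min_card (T : choiceType) (P : {fset T} -> Prop) : nat :=
  xget 0%N [set n | is_min_card P n].

Definition G_inv (k N : nat) : nat := min_card (basepoints_inv k N).
Definition G_AP (k N : nat) : nat := min_card (basepoints k N).
Definition F_AP (k N : nat) : nat := min_card (differences k N).

Definition log_ratio (R : realType) (f : nat -> nat -> nat) (k N : nat) : R :=
  ln (f k N)%:R / ln N%:R.

(* Both the existence of every inner limit (k >= 1) and the existence of the
   outer limit are part of the assertion. *)
Definition is_iterated_lim (R : realType) (u : nat -> nat -> R) (L : R) : Prop :=
  exists2 g : nat -> R,
    (forall k, (0 < k)%N -> u k N @[N --> \oo] --> g k) &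
    g k @[k --> \oo] --> L.

Lemma min_cardP (T : choiceType) (P : {fset T} -> Prop) :
  (exists S, P S) -> is_min_card P (min_card P).
Proof.
move=> [S0 PS0]; apply: (@xgetPex _ 0%N [set n | is_min_card P n]).
have ex : exists n, `[< exists2 S : {fset T}, P S & #|` S| = n >].
  by exists #|` S0|; apply/asboolP; exists S0.
exists (ex_minn ex); case: ex_minnP => n /asboolP hn hmin; split=> // S PS.
by apply: hmin; apply/asboolP; exists S.
Qed.

Lemma card_fset_int (N : nat) : #|` [fset (i%:Z)%R | i in iota 1 N]%fset| = N.
Proof.
rewrite card_imfset /=; last by move=> i j [].
by rewrite undup_id ?size_iota ?iota_uniq.
Qed.

Lemma fset_int_neq0 (N : nat) (a : int) :
  a \in [fset (i%:Z)%R | i in iota 1 N]%fset -> a != 0.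
Proof. by case/imfsetP=> i /=; rewrite mem_iota => /andP[i0 _] ->; case: i i0. Qed.

Lemma G_inv_min (k N : nat) : is_min_card (basepoints_inv k N) (G_inv k N).
Proof.
apply: min_cardP; pose B := [fset (i%:Z)%R | i in iota 1 N]%fset.
exists [fset (a%:~R + 1 * u)%R | a : int in B, u : rat in inv_interval1 k]%fset.
exists B; first exact: card_fset_int.
move=> a aB; exists 1 => //; apply/fsubsetP => y /imfsetP[u /= uU ->].
by apply/imfset2P; exists a => //; exists u.
Qed.

Lemma G_AP_min (k N : nat) : is_min_card (basepoints k N) (G_AP k N).
Proof.
apply: min_cardP; pose B := [fset (i%:Z)%R | i in iota 1 N]%fset.
exists [fset (a + 1 * u)%R | a in B, u in interval1 k]%fset.
exists B; first exact: card_fset_int.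
move=> a aB; exists 1 => //; apply/fsubsetP => y /imfsetP[u /= uU ->].
by apply/imfset2P; exists a => //; exists u.
Qed.

Lemma F_AP_min (k N : nat) : is_min_card (differences k N) (F_AP k N).
Proof.
apply: min_cardP; pose B := [fset (i%:Z)%R | i in iota 1 N]%fset.
exists [fset (0 + d * u)%R | d in B, u in interval1 k]%fset.
exists B; first exact: card_fset_int.
move=> d dB; split; first exact: fset_int_neq0 dB.
exists 0; apply/fsubsetP => y /imfsetP[u /= uU ->].
by apply/imfset2P; exists d => //; exists u.
Qed.

(* Main.v *)
Require Import Defs.
From mathcomp Require Import zify ring lra.

Set Implicit Arguments.
Unset Strict Implicit.
Unset Printing Implicit Defensive.

Local Open Scope classical_set_scope.
Local Open Scope ring_scope.

(** For fixed [k], [F_AP] and [G_AP] are monotone in [N] and submultiplicative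
    (combine two configurations through [(p, q) |-> p + T q] with [T] large), so
    Fekete's lemma gives the inner limits.  They are monotone in [k] and at most
    [1], as [F_AP k N <= k * N].

    Regard a progression as the line [x + d t] sampled at [t = 1, ..., k].  The
    projective map [t |-> 1 / t] exchanges intercept and slope: dividing by [t]
    turns it into [d + x / t], so [G_inv k] and [F_AP k] agree up to a factor
    depending on [k]; restricting to [t = k! / j], [j = 1, ..., k], turns
    progressions of length [k!] keyed by slope into progressions of length [k]
    keyed by basepoint, and conversely.  Hence the inner limits of [F_AP] and
    [G_AP] interlace along [k |-> k!].  Lines whose new slope would vanish are
    removed by a translation, or by dropping a single line. *)

(** * Minimal cardinalities recast as families of lines *)

Lemma min_card_leP (T : choiceType) (P : {fset T} -> Prop) (n m : nat) :
  is_min_card P n -> (n <= m)%N <-> exists2 S, P S & (#|` S| <= m)%N.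
Proof.
move=> [[S PS Sn] nmin]; split=> [nm|[S' PS' S'm]].
  by exists S; rewrite // Sn.
exact: leq_trans (nmin _ PS') S'm.
Qed.

Section Family.
Variables (T Y : choiceType) (y0 : Y) (ok : int -> Y -> bool) (pt : int -> Y -> nat -> T).

(* [family k N m]: some set of at most [m] points contains the first [k] points
   of at least [N] admissible lines [(b, y)] with distinct parameters [b]. *)
Definition family (k N m : nat) : Prop :=
  exists (L : seq (int * Y)) (S : seq T),
    [/\ (N <= size L)%N, uniq (map fst L), (size S <= m)%N &
        forall b y, (b, y) \in L ->
          ok b y /\ forall i, (0 < i <= k)%N -> pt b y i \in S].

(** This replaces bounds on a minimum by explicit configurations. Since [family] tolerates surplus
    lines and repeated points, later constructions never have to compute an exact cardinality:
    truncation to [N] parameters and removal of duplicates happen here. *)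
Lemma min_card_familyP (k N n m : nat) (P : {fset T} -> Prop) :
  (forall S, P S <-> exists2 B : {fset int}, #|` B| = N &
     forall b, b \in B -> exists y, ok b y /\
       forall i, (0 < i <= k)%N -> pt b y i \in S) ->
  is_min_card P n -> (n <= m)%N <-> family k N m.
Proof.
move=> PE /min_card_leP nP; apply: (iff_trans (nP m)); split.
  move=> [S /PE[B BN hB] Sm].
  have /choice[c hc] : forall b, exists y, b \in B -> ok b y /\
      forall i, (0 < i <= k)%N -> pt b y i \in S.
    move=> b; have [bB|bB] := boolP (b \in B); last by exists y0.
    by have [y hy] := hB b bB; exists y.
  exists [seq (b, c b) | b <- B], S; split=> //.
  - by rewrite size_map BN.
  - by rewrite -map_comp map_id_in // fset_uniq.
  - by move=> b y /mapP[b' b'B [-> ->]]; apply: hc.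
move=> [L [S [NL uL Sm hL]]]; exists [fset x in S]%fset; last first.
  by rewrite card_fseq; apply: leq_trans (size_undup _) Sm.
apply/PE; exists [fset b in take N (map fst L)]%fset.
  by rewrite card_fseq undup_id ?take_uniq // size_take size_map; case: ltngtP NL.
move=> b; rewrite inE /= => /mem_take /mapP[[b' y] /hL[oky hy] /= ->].
by exists y; split=> // i /hy; rewrite inE.
Qed.

Lemma family_le k k' N N' m : (k' <= k)%N -> (N' <= N)%N ->
  family k N m -> family k' N' m.
Proof.
move=> kk NN [L [S [NL uL Sm hL]]]; exists L, S; split=> //.
  exact: leq_trans NL.
move=> b y /hL[oky hy]; split=> // i /andP[i0 ik].
by apply: hy; rewrite i0; apply: leq_trans kk.
Qed.

Lemma family_gt0 k N m : (0 < k)%N -> (0 < N)%N -> family k N m -> (0 < m)%N.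
Proof.
move=> k0 N0 [[|[b y] L] [S [NL _ Sm hL]]]; first by case: N N0 NL.
have [_ /(_ 1%N)] := hL b y (mem_head _ _).
by rewrite /= k0 => /(_ isT); case: S Sm {hL} => //= a S Sm _; apply: leq_trans Sm.
Qed.

End Family.

(** * Separation of integers and clearing of denominators *)

Lemma int_bounded (s : seq int) : exists M : int, forall a, a \in s -> `|a| <= M.
Proof.
elim: s => [|b s [M hM]]; first by exists 0.
exists (`|b| + `|M|) => a; rewrite inE => /orP[/eqP->|/hM]; lia.
Qed.

(** If every element of [s] has absolute value at most [M], two of them differ by at most [2 * |M|],
    less than [T]; so digits from [s] in base [T] are determined by the number. *)
Lemma base_injective (s : seq int) : exists T : int, forall a b c d,
  a \in s -> b \in s -> c \in s -> d \in s ->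
  a + T * b = c + T * d -> a = c /\ b = d.
Proof.
have [M hM] := int_bounded s; exists (2 * `|M| + 1) => a b c d ha hb hc hd e.
have ha' := hM a ha; have hc' := hM c hc.
by case: (ltgtP b d) => bd; nia.
Qed.

Lemma uniq_map_inj_in (T U : eqType) (f : T -> U) (s : seq T) :
  uniq (map f s) -> {in s &, injective f}.
Proof.
elim: s => //= a s IH /andP[fa us] x y; rewrite !inE.
move=> /orP[/eqP->|xs] /orP[/eqP->|ys] e //; last exact: IH.
  by rewrite e map_f in fa.
by rewrite -e map_f in fa.
Qed.

(** Distinct parameters vanish at most once. This is the source of the shift from [N.+1] to [N] in
    the exchange lemmas. *)
Lemma fst_neq0_size (Y : eqType) (L : seq (int * Y)) : uniq (map fst L) ->
  (size L <= (size [seq p <- L | p.1 != 0%R]).+1)%N.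
Proof.
move=> uL; rewrite size_filter -(count_predC (fun p : int * Y => p.1 != 0) L) -addn1 leq_add2l.
rewrite (eq_count (a2 := preim fst (pred1 (0 : int)))); last by move=> p /=; rewrite negbK.
by rewrite -count_map count_uniq_mem //; case: (_ \in _).
Qed.

Lemma common_denominator (s : seq rat) : exists2 M : int, M != 0 &
  forall r, r \in s -> exists z : int, M%:~R * r = z%:~R.
Proof.
elim: s => [|r s [M M0 hM]]; first by exists 1.
exists (M * denq r); first by rewrite mulf_neq0 ?denq_neq0.
move=> q; rewrite inE => /orP[/eqP->|/hM[z hz]].
  exists (M * numq r); rewrite !intrM -mulrA; congr (_ * _).
  by rewrite mulrC -numqE.
by exists (denq r * z); rewrite !intrM -hz; ring.
Qed.

(** * Coding of the three extremal functions by lines *)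

(* A line is coded by its intercept and slope; [steep] selects which of the two
   is the distinguished first parameter. *)
Definition slope (steep : bool) (b y : int) := if steep then b else y.
Definition intercept (steep : bool) (b y : int) := if steep then y else b.

Definition AP_family (steep : bool) : nat -> nat -> nat -> Prop :=
  family (fun b y => slope steep b y != 0)
    (fun b y i => intercept steep b y + slope steep b y * i%:Z).

Definition inv_family : nat -> nat -> nat -> Prop :=
  family (fun (b : int) (y : rat) => y != 0) (fun b y i => b%:~R + y * i%:R^-1).

Lemma interval1_subP k (x r : int) (S : {fset int}) :
  (pattern (interval1 k) x r `<=` S)%fset <->
  forall i, (0 < i <= k)%N -> x + r * i%:Z \in S.
Proof.
split=> [/fsubsetP sub i ik|sub].
  apply: sub; apply/imfsetP; exists i%:Z => //=.
  by apply/imfsetP; exists i => //=; rewrite mem_iota add1n ltnS.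
apply/fsubsetP => _ /imfsetP[_ /= /imfsetP[i /= ik ->] ->].
by apply: sub; move: ik; rewrite mem_iota add1n ltnS.
Qed.

Lemma inv_interval1_subP k (x r : rat) (S : {fset rat}) :
  (pattern (inv_interval1 k) x r `<=` S)%fset <->
  forall i, (0 < i <= k)%N -> x + r * i%:R^-1 \in S.
Proof.
split=> [/fsubsetP sub i ik|sub].
  apply: sub; apply/imfsetP; exists (i%:R^-1) => //=.
  by apply/imfsetP; exists i => //=; rewrite mem_iota add1n ltnS.
apply/fsubsetP => _ /imfsetP[_ /= /imfsetP[i /= ik ->] ->].
by apply: sub; move: ik; rewrite mem_iota add1n ltnS.
Qed.

Lemma G_AP_leP k N m : (G_AP k N <= m)%N <-> AP_family false k N m.
Proof.
apply: (min_card_familyP 0 m _ (G_AP_min k N)) => S; split=> -[B BN hB]; exists B => // b /hB.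
  by move=> [r r0 /interval1_subP sub]; exists r.
by move=> [r [r0 sub]]; exists r => //; apply/interval1_subP.
Qed.

Lemma F_AP_leP k N m : (F_AP k N <= m)%N <-> AP_family true k N m.
Proof.
apply: (min_card_familyP 0 m _ (F_AP_min k N)) => S; split=> -[B BN hB]; exists B => // b /hB.
  by move=> [b0 [x /interval1_subP sub]]; exists x.
by move=> [x [b0 sub]]; split=> //; exists x; apply/interval1_subP.
Qed.

Lemma G_inv_leP k N m : (G_inv k N <= m)%N <-> inv_family k N m.
Proof.
apply: (min_card_familyP 0 m _ (G_inv_min k N)) => S; split=> -[B BN hB]; exists B => // b /hB.
  by move=> [r r0 /inv_interval1_subP sub]; exists r.
by move=> [r [r0 sub]]; exists r => //; apply/inv_interval1_subP.
Qed.

(** * Product construction and the linear upper bound *)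

Lemma AP_family_mul steep k M N m n :
  AP_family steep k M m -> AP_family steep k N n ->
  AP_family steep k (M * N) (m * n).
Proof.
move=> [L1 [S1 [NL1 uL1 Sm1 hL1]]] [L2 [S2 [NL2 uL2 Sm2 hL2]]].
(* Including 0 among the digits lets the same injectivity show that a combined slope is nonzero:
   otherwise it would have the digits of 0. *)
pose s := 0 :: map fst L1 ++ map snd L1 ++ map fst L2 ++ map snd L2.
have [T Tinj] := base_injective s.
have s1 p : p \in L1 -> p.1 \in s /\ p.2 \in s.
  by move=> pL; rewrite !(inE, mem_cat) !(map_f _ pL) !orbT.
have s2 p : p \in L2 -> p.1 \in s /\ p.2 \in s.
  by move=> pL; rewrite !(inE, mem_cat) !(map_f _ pL) !orbT.
have s0 : 0 \in s by rewrite mem_head.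
pose comb (p q : int * int) := (p.1 + T * q.1, p.2 + T * q.2).
exists [seq comb p q | p <- L1, q <- L2], [seq a + T * c | a <- S1, c <- S2].
split; rewrite ?size_allpairs ?leq_mul //.
  rewrite map_allpairs; apply: allpairs_uniq.
  - exact: map_uniq uL1.
  - exact: map_uniq uL2.
  move=> _ _ /allpairsP[[p q] /= [p1 q2 ->]] /allpairsP[[p' q'] /= [p1' q2' ->]] /= e.
  have [e1 e2] := Tinj _ _ _ _ (s1 _ p1).1 (s2 _ q2).1 (s1 _ p1').1 (s2 _ q2').1 e.
  by rewrite (uniq_map_inj_in uL1 p1 p1' e1) (uniq_map_inj_in uL2 q2 q2' e2).
move=> b y /allpairsP[[[b1 y1] [b2 y2]] /= [h1 h2 [-> ->]]].
have [ok1 pt1] := hL1 _ _ h1; have [ok2 pt2] := hL2 _ _ h2.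
split.
  apply/eqP => e.
  have : slope steep b1 y1 + T * slope steep b2 y2 = 0 + T * 0.
    by rewrite mulr0 addr0 -e; case: (steep).
  case/Tinj => //; last by move/eqP; rewrite (negbTE ok1).
  - by case: (steep); case: (s1 _ h1).
  - by case: (steep); case: (s2 _ h2).
move=> i ik; apply/allpairsP.
exists (intercept steep b1 y1 + slope steep b1 y1 * i%:Z,
        intercept steep b2 y2 + slope steep b2 y2 * i%:Z).
split; [exact: pt1|exact: pt2|].
by rewrite /=; case: (steep); rewrite /slope /intercept; ring.
Qed.

Lemma AP_family_trivial k N : AP_family true k N (k * N).
Proof.
(* All lines pass through the origin, with slopes [1, ..., N]. *)
exists [seq (n%:Z, 0 : int) | n <- iota 1 N], [seq n%:Z * i%:Z | i <- iota 1 k, n <- iota 1 N].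
split.
- by rewrite size_map size_iota.
- by rewrite -map_comp map_inj_uniq ?iota_uniq // => a b [].
- by rewrite size_allpairs !size_iota.
move=> b y /mapP[n]; rewrite mem_iota => /andP[n0 nN] [-> ->]; split; first by rewrite /slope; lia.
move=> i ik; rewrite add0r; apply/allpairsP; exists (i, n).
by rewrite !mem_iota !add1n !ltnS in nN *; rewrite n0 nN.
Qed.

(** * Exchange of intercept and slope *)

(* Translating the point set makes every intercept nonzero. *)
Lemma steep_family_translate k N m : AP_family true k N m ->
  family (fun b y : int => (b != 0) && (y != 0)) (fun b y i => y + b * i%:Z) k N m.
Proof.
move=> [L [S [NL uL Sm hL]]].
have [M hM] := int_bounded (map snd L).
exists [seq (p.1, p.2 + (M + 1)) | p <- L], [seq a + (M + 1) | a <- S].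
split; rewrite ?size_map // -?map_comp //.
move=> b y /mapP[[b' y'] h [-> ->]] /=; have [ok pt] := hL _ _ h.
have := hM y' (map_f snd h).
split; first by rewrite ok /=; lia.
by move=> i ik; apply/mapP; exists (y' + b' * i%:Z); [exact: pt|ring].
Qed.

Lemma dvd_fact_div j k : (0 < j <= k)%N ->
  (0 < k`! %/ j <= k`!)%N /\ j%:Z * (k`! %/ j)%:Z = k`!%:Z.
Proof.
move=> /andP[j0 jk]; have jd : (j %| k`!)%N by rewrite dvdn_fact // j0.
rewrite divn_gt0 // leq_div dvdn_leq ?fact_gt0 //.
by rewrite -PoszM mulnC divnK.
Qed.

(* At [i = k! / j], the line [x + i d] scaled by [j] is [k! d + j x]: intercept
   and slope are exchanged and the times [k! / j] become the times [j]. *)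
Lemma family_steep_flat k N m : AP_family true k`! N m ->
  AP_family false k N (k * m).
Proof.
move/steep_family_translate => [L [S [NL uL Sm hL]]].
exists [seq (k`!%:Z * p.1, p.2) | p <- L], [seq j%:Z * a | j <- iota 1 k, a <- S].
split; rewrite ?size_map ?size_allpairs ?size_iota ?leq_mul2l ?Sm ?orbT //.
  rewrite -map_comp (map_comp (fun b : int => k`!%:Z * b)) map_inj_uniq //.
  by apply: mulfI; rewrite -lt0n fact_gt0.
move=> b y /mapP[[b' y'] /hL[/andP[b0 y0] pt] [-> ->]]; split=> // j jk.
have [ik e] := dvd_fact_div jk.
apply/allpairsP; exists (j, y' + b' * (k`! %/ j)%:Z); split.
- by rewrite mem_iota add1n ltnS.
- exact: pt.
by rewrite /slope /intercept /= -e; ring.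
Qed.

(** The point of [b + y t] at [t = k! / j], scaled by [j], is [k! y + j b]. The old basepoint [b]
    becomes the slope, so a line with [b = 0] is dropped. *)
Lemma family_flat_steep k N m : AP_family false k`! N.+1 m ->
  AP_family true k N (k * m).
Proof.
move=> [L [S [NL uL Sm hL]]].
exists [seq (p.1, k`!%:Z * p.2) | p <- [seq p <- L | p.1 != 0]],
  [seq j%:Z * a | j <- iota 1 k, a <- S].
split; rewrite ?size_map ?size_allpairs ?size_iota ?leq_mul2l ?Sm ?orbT //.
- by have := leq_trans NL (fst_neq0_size uL).
- by rewrite -map_comp; apply: subseq_uniq uL; apply: map_subseq; apply: filter_subseq.
move=> b y /mapP[[b' y']]; rewrite mem_filter => /andP[b0 /hL[y0 pt]] [-> ->]; split=> // j jk.
have [ik e] := dvd_fact_div jk.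
apply/allpairsP; exists (j, b' + y' * (k`! %/ j)%:Z); split.
- by rewrite mem_iota add1n ltnS.
- exact: pt.
by rewrite /slope /intercept /= -e; ring.
Qed.

(* Dividing [x + i d] by [i] gives [d + x / i]. *)
Lemma family_steep_inv k N m : AP_family true k N m -> inv_family k N (k * m).
Proof.
move/steep_family_translate => [L [S [NL uL Sm hL]]].
exists [seq (p.1, p.2%:~R) | p <- L], [seq a%:~R / i%:R | i <- iota 1 k, a <- S].
split; rewrite ?size_map ?size_allpairs ?size_iota ?leq_mul2l ?Sm ?orbT // -?map_comp //.
move=> b y /mapP[[b' y'] /hL[/andP[b0 y0] pt] [-> ->]]; split; first by rewrite intr_eq0.
move=> i ik; apply/allpairsP; exists (i, y' + b' * i%:Z); split.
- by rewrite mem_iota add1n ltnS.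
- exact: pt.
have i0 : i%:R != 0 :> rat by rewrite pnatr_eq0 -lt0n; case/andP: ik.
by rewrite /= intrD intrM -pmulrn; field.
Qed.

(** Scaling [b + y / i] by [M i] gives [M y + (M b) i], an integer once [M] clears the denominators
    of the scaling factors; [numq] then reads it off. The slope [M b] excludes [b = 0]. *)
Lemma family_inv_steep k N m : inv_family k N.+1 m -> AP_family true k N (k * m).
Proof.
move=> [L [S [NL uL Sm hL]]].
have [M M0 hM] := common_denominator (map snd L).
exists [seq (M * p.1, numq (M%:~R * p.2)) | p <- [seq p <- L | p.1 != 0]],
  [seq numq (M%:~R * i%:R * a) | i <- iota 1 k, a <- S].
split; rewrite ?size_map ?size_allpairs ?size_iota ?leq_mul2l ?Sm ?orbT //.
- by have := leq_trans NL (fst_neq0_size uL).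
- rewrite -map_comp (map_comp (fun b : int => M * b)) map_inj_uniq; last exact: mulfI.
  by apply: subseq_uniq uL; apply: map_subseq; apply: filter_subseq.
move=> b y /mapP[[b' y']]; rewrite mem_filter => /andP[b0 h] [-> ->].
have [_ pt] := hL _ _ h; split; first by rewrite mulf_neq0.
have [z hz] := hM _ (map_f snd h); rewrite /= in hz *.
move=> i ik; apply/allpairsP; exists (i, b'%:~R + y' * i%:R^-1); split.
- by rewrite mem_iota add1n ltnS.
- exact: pt.
have i0 : i%:R != 0 :> rat by rewrite pnatr_eq0 -lt0n; case/andP: ik.
rewrite /= hz numq_int.
have -> : M%:~R * i%:R * (b'%:~R + y' * i%:R^-1) = (z + M * b' * i%:Z)%:~R.
  by rewrite intrD !intrM -hz -pmulrn; field.
by rewrite numq_int.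
Qed.

(** * Growth exponents for fixed [k] *)

Section LogRatio.
Variable R : realType.
Implicit Types f g : nat -> nat.

Definition lnratio f (N : nat) : R := ln (f N)%:R / ln N%:R.

Lemma ln_nat_ge0 n : 0 <= ln n%:R :> R.
Proof. by case: n => [|n]; [rewrite ln0 | rewrite ln_ge0 // ler1n]. Qed.

Lemma ln_nat_gt0 n : (1 < n)%N -> 0 < ln n%:R :> R.
Proof. by move=> n1; rewrite ln_gt0 // ltr1n. Qed.

Lemma ler_ln_nat m n : (0 < m)%N -> (m <= n)%N -> ln m%:R <= ln n%:R :> R.
Proof.
by move=> m0 mn; rewrite ler_ln ?ler_nat // posrE ltr0n //; apply: leq_trans mn.
Qed.

Lemma ln_natM m n : (0 < m)%N -> (0 < n)%N ->
  ln (m * n)%:R = ln m%:R + ln n%:R :> R.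
Proof. by move=> m0 n0; rewrite natrM lnM // posrE ltr0n. Qed.

(** This is why factors independent of [N] do not affect the exponents. *)
Lemma div_ln_nat_cvg0 (c : R) : c / ln N%:R @[N --> \oo] --> (0 : R).
Proof.
rewrite -[0 in X in _ --> X](mulr0 c); apply: cvgMl_tmp.
apply/gtr0_cvgV0.
  near=> N; apply: ln_nat_gt0; near: N; exact: nbhs_infty_gt.
apply/cvgryPge => A; near=> N.
have AN : expR A <= N%:R by near: N; exact: nbhs_infty_ger.
rewrite -[A]expRK ler_ln // posrE ?expR_gt0 //.
exact: lt_le_trans (expR_gt0 A) AN.
Unshelve. all: by end_near. Qed.

Lemma lnratio_le f g C N : (1 < N)%N -> (0 < f N)%N -> (f N <= C * g N)%N ->
  lnratio f N <= lnratio g N + ln C%:R / ln N%:R.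
Proof.
move=> N1 f0 fg; rewrite /lnratio -mulrDl ler_pM2r ?invr_gt0 ?ln_nat_gt0 //.
have : (0 < C * g N)%N by apply: leq_trans fg.
rewrite muln_gt0 => /andP[C0 g0].
by rewrite addrC -ln_natM //; apply: ler_ln_nat.
Qed.

Lemma lnratio_cvg_le f g C (a b : R) :
  (forall N, (1 < N)%N -> (0 < f N)%N) ->
  (forall N, (1 < N)%N -> (f N <= C * g N)%N) ->
  lnratio f N @[N --> \oo] --> a -> lnratio g N @[N --> \oo] --> b -> a <= b.
Proof.
move=> f0 fg fa gb; rewrite -[b]addr0.
apply: (ler_cvg_to fa (cvgD gb (div_ln_nat_cvg0 (ln C%:R)))).
near=> N; have N1 : (1 < N)%N by near: N; exact: nbhs_infty_gt.
by apply: lnratio_le; [|exact: f0|exact: fg].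
Unshelve. all: by end_near. Qed.

Lemma lnratio_cvg_equiv f g C D (a : R) :
  (forall N, (1 < N)%N -> (0 < f N)%N) ->
  (forall N, (1 < N)%N -> (f N <= C * g N)%N) ->
  (forall N, (1 < N)%N -> (g N <= D * f N)%N) ->
  lnratio f N @[N --> \oo] --> a -> lnratio g N @[N --> \oo] --> a.
Proof.
move=> f0 fg gf fa.
have lo : lnratio f N - ln C%:R / ln N%:R @[N --> \oo] --> a.
  by rewrite -[a in X in _ --> X]subr0; apply: cvgB => //; exact: div_ln_nat_cvg0.
have hi : lnratio f N + ln D%:R / ln N%:R @[N --> \oo] --> a.
  by rewrite -[a in X in _ --> X]addr0; apply: cvgD => //; exact: div_ln_nat_cvg0.
apply: squeeze_cvgr lo hi.
near=> N; have N1 : (1 < N)%N by near: N; exact: nbhs_infty_gt.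
rewrite lerBlDr; apply/andP; split.
  by apply: lnratio_le; [|exact: f0|exact: fg].
apply: lnratio_le; [by []| |exact: gf].
have : (0 < C * g N)%N by apply: leq_trans (fg N N1); exact: f0.
by rewrite muln_gt0 => /andP[].
Unshelve. all: by end_near. Qed.

(* Fekete's lemma in multiplicative form: the limit is the infimum over M >= 2. *)
Lemma lnratio_fekete f :
  (forall N, (0 < N)%N -> (0 < f N)%N) ->
  (forall M N, (M <= N)%N -> (f M <= f N)%N) ->
  (forall M N, (f (M * N) <= f M * f N)%N) ->
  cvg (lnratio f N @[N --> \oo]).
Proof.
move=> f0 fmono fmul.
have fX M e : (f (M ^ e.+1) <= f M ^ e.+1)%N.
  elim: e => [|e IH]; first by rewrite !expn1.
  by rewrite expnS (expnS (f M)); apply: leq_trans (fmul _ _) _; rewrite leq_mul2l IH orbT.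
(* With [M ^ e <= N < M ^ e.+1], submultiplicativity bounds [f N] by [f M ^ e.+1]. The first [e]
   factors contribute at most [lnratio f M], and the last one gives the error term. *)
have key M N : (1 < M)%N -> (1 < N)%N ->
    lnratio f N <= lnratio f M + ln (f M)%:R / ln N%:R.
  move=> M1 N1; have M0 := ltnW M1; have N0 := ltnW N1.
  pose e := trunc_log M N.
  have fN : (f N <= f M ^ e.+1)%N.
    by apply: leq_trans (fX _ _); apply: fmono; apply/ltnW/trunc_log_ltn.
  have lnfN : ln (f N)%:R <= ln (f M)%:R *+ e.+1 :> R.
    rewrite -lnXn ?ltr0n ?f0 // -natrX; apply: ler_ln_nat fN; exact: f0.
  have lnN : ln M%:R *+ e <= ln N%:R :> R.
    rewrite -lnXn ?ltr0n // -natrX; apply: ler_ln_nat; first by rewrite expn_gt0 M0.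
    exact: trunc_logP.
  have lM := ln_nat_gt0 M1; have lN := ln_nat_gt0 N1.
  rewrite /lnratio ler_pdivrMr // mulrDl divfK ?gt_eqF //.
  apply: le_trans lnfN _; rewrite mulrS addrC lerD2r -mulrA -[leLHS]mulr_natr.
  apply: ler_wpM2l; first exact: ln_nat_ge0.
  by rewrite ler_pdivlMl // mulr_natr.
pose E := [set lnratio f M | M in [set M : nat | (1 < M)%N]].
have lbE : lbound E 0.
  by move=> _ [M M1 <-]; rewrite divr_ge0 ?ln_nat_ge0.
have infE : has_inf E by split; [exists (lnratio f 2); exists 2%N | exists 0].
apply/cvg_ex; exists (inf E); apply/cvgrPdist_lt => eps eps0.
have eps20 : 0 < eps / 2 by rewrite divr_gt0.
have [_ [M M1 <-] ME] := inf_adherent eps20 infE.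
have /cvgrPdist_lt/(_ _ eps20) sm := div_ln_nat_cvg0 (ln (f M)%:R).
near=> N; have N1 : (1 < N)%N by near: N; exact: nbhs_infty_gt.
have : `|0 - ln (f M)%:R / ln N%:R| < eps / 2 :> R by near: N.
rewrite sub0r normrN ger0_norm ?divr_ge0 ?ln_nat_ge0 // => sN.
have lo : inf E <= lnratio f N by apply: ge_inf; [exists 0 | exists N].
have := key M N M1 N1; rewrite distrC ger0_norm ?subr_ge0 //.
by lra.
Unshelve. all: by end_near. Qed.

(** * Comparison of the exponents as [k] grows *)

Lemma iterated_lim_equal (F G H : nat -> nat -> nat) :
  (forall k N, (0 < k)%N -> (0 < N)%N -> (0 < F k N)%N) ->
  (forall k N, (0 < k)%N -> (0 < N)%N -> (0 < G k N)%N) ->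
  (forall k M N, (M <= N)%N -> (F k M <= F k N)%N) ->
  (forall k M N, (M <= N)%N -> (G k M <= G k N)%N) ->
  (forall k M N, (F k (M * N) <= F k M * F k N)%N) ->
  (forall k M N, (G k (M * N) <= G k M * G k N)%N) ->
  (forall k l N, (k <= l)%N -> (F k N <= F l N)%N) ->
  (forall k l N, (k <= l)%N -> (G k N <= G l N)%N) ->
  (forall k N, (F k N <= k * N)%N) ->
  (forall k N, (F k N <= k * G k`! N.+1)%N) ->
  (forall k N, (G k N <= k * F k`! N)%N) ->
  (forall k N, (F k N <= k * H k N.+1)%N) ->
  (forall k N, (H k N <= k * F k N)%N) ->
  exists L : R, [/\ is_iterated_lim (@log_ratio R H) L,
    is_iterated_lim (@log_ratio R G) L & is_iterated_lim (@log_ratio R F) L].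
Proof.
move=> F0 G0 FN GN FM GM Fk Gk FkN FG GF FH HF.
pose gF k := lim (lnratio (F k) N @[N --> \oo]).
pose gG k := lim (lnratio (G k) N @[N --> \oo]).
have cF k : (0 < k)%N -> lnratio (F k) N @[N --> \oo] --> gF k.
  by move=> k0; apply: lnratio_fekete => [N|M N|M N]; [exact: F0|exact: FN|exact: FM].
have cG k : (0 < k)%N -> lnratio (G k) N @[N --> \oo] --> gG k.
  by move=> k0; apply: lnratio_fekete => [N|M N|M N]; [exact: G0|exact: GN|exact: GM].
have F0' k N : (0 < k)%N -> (1 < N)%N -> (0 < F k N)%N.
  by move=> k0 N1; apply: F0 => //; apply: ltnW.
have G0' k N : (0 < k)%N -> (1 < N)%N -> (0 < G k N)%N.
  by move=> k0 N1; apply: G0 => //; apply: ltnW.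
have cH k : (0 < k)%N -> lnratio (H k) N @[N --> \oo] --> gF k.
  (* The factor [F k 2] absorbs the shift in [FH]: as [N <= 2 * (N - 1)] for [N > 1], [F k N] is at
     most [F k 2 * F k (N - 1)]. *)
  move=> k0; apply: (lnratio_cvg_equiv (C := F k 2 * k) (D := k) _ _ _ (cF k k0)) => // N N1.
  - exact: F0'.
  - case: N N1 => [|[|N]] // _; rewrite -mulnA.
    apply: leq_trans (FN k _ (2 * N.+1)%N _) _; first by lia.
    by apply: leq_trans (FM _ _ _) _; rewrite leq_mul2l FH orbT.
have gFmono k l : (0 < k)%N -> (k <= l)%N -> gF k <= gF l.
  move=> k0 kl; have l0 := leq_trans k0 kl.
  apply: (lnratio_cvg_le (C := 1) _ _ (cF k k0) (cF l l0)) => N N1; first exact: F0'.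
  by rewrite mul1n Fk.
have gGmono k l : (0 < k)%N -> (k <= l)%N -> gG k <= gG l.
  move=> k0 kl; have l0 := leq_trans k0 kl.
  apply: (lnratio_cvg_le (C := 1) _ _ (cG k k0) (cG l l0)) => N N1; first exact: G0'.
  by rewrite mul1n Gk.
have gFG k : (0 < k)%N -> gF k <= gG k`!.
  move=> k0; have l0 := fact_gt0 k.
  (* The shift is absorbed in the same way, now through [N.+1 <= 2 * N]. *)
  apply: (lnratio_cvg_le (C := k * G k`! 2) _ _ (cF k k0) (cG _ l0)) => N N1; first exact: F0'.
  apply: leq_trans (FG _ _) _; rewrite -mulnA leq_mul2l; apply/orP; right.
  by apply: leq_trans (GN _ _ (2 * N)%N _) (GM _ _ _); lia.
have gGF k : (0 < k)%N -> gG k <= gF k`!.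
  move=> k0; have l0 := fact_gt0 k.
  by apply: (lnratio_cvg_le (C := k) _ _ (cG k k0) (cF _ l0)) => N N1; [exact: G0'|].
have gF1 k : (0 < k)%N -> gF k <= 1.
  (* The comparison function [id] has exponent 1. *)
  move=> k0; apply: (lnratio_cvg_le (C := k) (g := id) _ _ (cF k k0)) => [N N1|N _|].
  - exact: F0'.
  - exact: FkN.
  - apply: cvg_near_cst; near=> N.
    by rewrite /lnratio divff // gt_eqF // ln_nat_gt0 //; near: N; exact: nbhs_infty_gt.
(* The index starts at 1 because nothing is known about [gF 0]. *)
have cvF : cvg (gF k.+1 @[k --> \oo]).
  apply: nondecreasing_is_cvgn => [m n mn|]; first exact: gFmono.
  by exists 1 => _ [n _ <-]; apply: gF1.
pose L := lim (gF k.+1 @[k --> \oo]).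
have gFL : gF k @[k --> \oo] --> L by rewrite -cvg_shiftS.
have gFleL k : (0 < k)%N -> gF k <= L.
  case: k => // k _; apply: (nondecreasing_cvgn_le (u_ := fun k => gF k.+1)) => // m n mn.
  exact: gFmono.
have gGleL k : (0 < k)%N -> gG k <= L.
  by move=> k0; apply: le_trans (gGF k k0) _; apply: gFleL; apply: fact_gt0.
have gGL : gG k @[k --> \oo] --> L.
  apply/cvgrPdist_lt => eps eps0.
  have /cvgrPdist_lt/(_ _ eps0) [K _ hK] := gFL.
  have := hK K.+1 (leqnSn K); rewrite /= => hK'.
  (* For such [k], [gF K.+1 <= gG K.+1! <= gG k <= L], and the first term is already within [eps] of
     [L]. *)
  near=> k; have Kk : (K.+1`! <= k)%N by near: k; exact: nbhs_infty_ge.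
  have l0 := fact_gt0 K.+1; have k0 := leq_trans l0 Kk.
  have h1 := gFG K.+1 isT; have h2 := gGmono _ _ l0 Kk.
  have h3 := gGleL k k0; have h4 := gFleL K.+1 isT.
  move: hK'; rewrite !ger0_norm ?subr_ge0 //.
  by lra.
by exists L; split; [exists gF | exists gG | exists gF].
Unshelve. all: by end_near. Qed.

End LogRatio.

Theorem mainTheorem2 (R : realType) :
  exists L : R,
    [/\ is_iterated_lim (@log_ratio R G_inv) L,
        is_iterated_lim (@log_ratio R G_AP) L
      & is_iterated_lim (@log_ratio R F_AP) L].
Proof.
have FP k N := (F_AP_leP k N _).1 (leqnn _).
have GP k N := (G_AP_leP k N _).1 (leqnn _).
have HP k N := (G_inv_leP k N _).1 (leqnn _).
apply: iterated_lim_equal.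
- by move=> k N k0 N0; apply: family_gt0 (FP k N).
- by move=> k N k0 N0; apply: family_gt0 (GP k N).
- by move=> k M N MN; apply/F_AP_leP; apply: family_le MN (FP k N).
- by move=> k M N MN; apply/G_AP_leP; apply: family_le MN (GP k N).
- by move=> k M N; apply/F_AP_leP; apply: AP_family_mul.
- by move=> k M N; apply/G_AP_leP; apply: AP_family_mul.
- by move=> k l N kl; apply/F_AP_leP; apply: family_le kl _ (FP l N).
- by move=> k l N kl; apply/G_AP_leP; apply: family_le kl _ (GP l N).
- by move=> k N; apply/F_AP_leP; apply: AP_family_trivial.
- by move=> k N; apply/F_AP_leP; apply: family_flat_steep.
- by move=> k N; apply/G_AP_leP; apply: family_steep_flat.
- by move=> k N; apply/F_AP_leP; apply: family_inv_steep.
- by move=> k N; apply/G_inv_leP; apply: family_steep_inv.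
Qed.
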